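(* Let $r,s\ge 3$ and $1\le t<r$ be integers, and let $\mathcal{H}_\Theta=\Theta_t^r(\ell_1,\dots,\ell_s)$. Then: (i) if $t<\frac r2$, then $\chi^{e}(\mathcal{H}_\Theta)=1$; (ii) if $t>\frac r2$: if $r-t$ divides $r$ and $\ell_i>2(k-1)$ for some $1\le i\le s$, where $k=\frac{r}{r-t}$, then $\chi^{e}(\mathcal{H}_\Theta)=2$; otherwise $\chi^{e}(\mathcal{H}_\Theta)=1$; (iii) if $t=\frac r2$, then $\chi^{e}(\mathcal{H}_\Theta)=3$ if $\ell_1=1$ and $\ell_i\equiv 1\pmod 4$ for all $2\le i\le s$; $\chi^{e}(\mathcal{H}_\Theta)=1$ if $\ell_i=2$ for all $1\le i\le s$; and $\chi^{e}(\mathcal{H}_\Theta)=2$ otherwise.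
   Context: An $r$-uniform $t$-tight path of length $\ell$ is a hypergraph on vertices $1,\dots,n$ with $n=t+\ell(r-t)$ and edges $e_i=\{(i-1)(r-t)+1,\dots,(i-1)(r-t)+r\}$, $1\le i\le \ell$. The theta hypergraph $\Theta_t^r(\ell_1,\dots,\ell_s)$ is obtained from vertex-disjoint $r$-uniform $t$-tight paths $p_1,\dots,p_s$ of lengths $\ell_1,\dots,\ell_s$ by identifying the first $t$ vertices of all the $p_i$ (calling them $x_1,\dots,x_t$) and identifying the last $t$ vertices of all the $p_i$ (calling them $y_1,\dots,y_t$). For $w:E\to\{1,\dots,k\}$, $\sigma^{e}(v)=\sum_{e\ni v}w(e)$; a vertex coloring is proper if every edge contains two vertices of distinct colors; $\chi^{e}(\mathcal{H})$ is the least $k$ such that some $w$ makes $\sigma^{e}$ proper.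
   Formalization: It is assumed that every path has length at least 1 and at least 2t vertices (so the x_j and y_j are distinct), and in (iii) that only the first path may have length 1; otherwise the claim fails, e.g. for lengths (5,1,5) with t=r/2, or (1,3,3) with r=4, t=3. *)

(* Defs.v *)
From mathcomp Require Import all_boot.

Set Implicit Arguments.
Unset Strict Implicit.
Unset Printing Implicit Defensive.

Record hypergraph (T : finType) := Hypergraph {
  vertices : {set T};
  edges : {set {set T}}
}.

Section EdgeWeighting.
Variables (T : finType) (H : hypergraph T).

(* Only the values of w on edges H are ever used. *)
Definition edge_sum (w : {set T} -> nat) (v : T) : nat :=
  \sum_(e in edges H | v \in e) w e.

Definition proper_coloring (c : T -> nat) : Prop :=
  forall e, e \in edges H ->
  exists u v, [/\ u \in e, v \in e & c u <> c v].

Definition edge_weightable (k : nat) : Prop :=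
  exists w : {set T} -> nat,
    (forall e, e \in edges H -> 1 <= w e <= k) /\
    proper_coloring (edge_sum w).

(* chi^e(H) = k; it has no value when no edge weighting of H is proper. *)
Definition chi_e_is (k : nat) : Prop :=
  edge_weightable k /\ (forall j, edge_weightable j -> k <= j).

End EdgeWeighting.

(* Positions on a path and indices of its edges are counted from 0. *)
Definition path_vertex (r t len : nat) : finType := 'I_(t + len * (r - t)).

Definition tight_path_edge (r t len : nat) (i : 'I_len) :
    {set path_vertex r t len} :=
  [set p : path_vertex r t len | i * (r - t) <= p < i * (r - t) + r].

Definition tight_path (r t len : nat) : hypergraph (path_vertex r t len) :=
  Hypergraph setT [set tight_path_edge r t i | i : 'I_len].

Section Theta.
Variables (r t s : nat) (l : 'I_s -> nat).

Definition paths_vertex : finType := {i : 'I_s & path_vertex r t (l i)}.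

(* The last t positions of the i-th path are l i * (r - t) + j for j < t. *)
Definition identified (u v : paths_vertex) : bool :=
  [exists j : 'I_t,
     ((tagged u == j :> nat) && (tagged v == j :> nat)) ||
     ((tagged u == l (tag u) * (r - t) + j :> nat) &&
      (tagged v == l (tag v) * (r - t) + j :> nat))].

(* The vertices of the theta hypergraph are the classes of the equivalence
   relation generated by [identified], which is symmetric. *)
Definition vertex_class (u : paths_vertex) : {set paths_vertex} :=
  [set v | connect identified u v].

Definition theta : hypergraph {set paths_vertex} :=
  Hypergraph
    [set vertex_class u | u : paths_vertex]
    (\bigcup_(i < s)
       [set [set vertex_class (Tagged (fun i => path_vertex r t (l i)) p)
              | p in (e : {set path_vertex r t (l i)})]
         | e in edges (tight_path r t (l i))]).

End Theta.

(* Main.v *)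
(* Let d = r - t.  Along a path, moving from position p-1 to p enters the edge
   starting at p (if d divides p) and leaves the edge that ended at p-1, so the
   vertex sum changes by the difference of at most two weights; on the shared
   vertices x_j, y_j these changes add up over all the paths.  Hence with all
   weights 1 an edge is monochromatic only if at each of its inner multiples of d
   an edge is entered and another one left, which forces d to divide r and both
   ends of the path to be far away.  There, for k = r / d >= 3, weight 2 on the
   edges whose index is a multiple of k-1 breaks the balance.  For k = 2, merging
   blocks of t vertices gives a graph, where an inner edge j+1 is fine iff
   w(j) <> w(j+2); with weights in {1,2} this forces period 4 and leaves the two
   first weights of each path free.  When the first path is a single edge it
   needs distinct sums at its two ends, which is impossible exactly if every
   other length is 1 mod 4, as then first and last weights agree on each path. *)
Require Import Defs.
From mathcomp Require Import all_boot.
From mathcomp Require Import zify.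

Set Implicit Arguments.
Unset Strict Implicit.
Unset Printing Implicit Defensive.

(** * The part of a vertex sum contributed by a single path *)

Definition window_sum (d r len : nat) (f : nat -> nat) (p : nat) : nat :=
  \sum_(j < len | j * d <= p < j * d + r) f j.

(** Moving to [p.+1] enters the edges starting there and leaves those whose last position is [p];
    the additive form avoids truncated subtraction. *)
Lemma window_sum_step d r len f p :
  window_sum d r len f p.+1 + \sum_(j < len | j * d + r == p.+1) f j =
  window_sum d r len f p + \sum_(j < len | j * d == p.+1) f j.
Proof.
rewrite /window_sum big_mkcond [X in _ + X = _]big_mkcond -big_split /=.
rewrite [in RHS]big_mkcond [X in _ = _ + X]big_mkcond -big_split /=.
apply: eq_bigr => j _; case: ifP; case: ifP; case: ifP; case: ifP; lia.
Qed.

Lemma leq_window_sum d r len f p j :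
  j < len -> j * d <= p < j * d + r -> f j <= window_sum d r len f p.
Proof.
move=> jl hj; rewrite /window_sum (bigD1 (Ordinal jl)) //=.
exact: leq_addr.
Qed.

Lemma leq_window_sum2 d r len f p j j' : j != j' ->
  j < len -> j * d <= p < j * d + r -> j' < len -> j' * d <= p < j' * d + r ->
  f j + f j' <= window_sum d r len f p.
Proof.
move=> jj' jl hj jl' hj'; rewrite /window_sum (bigD1 (Ordinal jl)) //=.
rewrite (bigD1 (Ordinal jl')) /= ?leq_add2l ?leq_addr //.
by rewrite hj' -val_eqE /= eq_sym.
Qed.

Lemma sum_eq_mul d len (f : nat -> nat) j : 0 < d -> j < len ->
  \sum_(i < len | i * d == j * d) f i = f j.
Proof.
move=> d0 jl; rewrite (big_pred1 (Ordinal jl)) // => i.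
by rewrite eqn_pmul2r // -val_eqE.
Qed.

Lemma window_sum_gain d r len f j : 0 < d -> 0 < j < len ->
  (forall i, i * d + r != j * d) ->
  window_sum d r len f (j * d) = window_sum d r len f (j * d).-1 + f j.
Proof.
move=> d0 /andP[j0 jl] nl.
have := window_sum_step d r len f (j * d).-1.
by rewrite prednK ?muln_gt0 ?j0 // sum_eq_mul // big_pred0 ?addn0 // => i;
  apply/negbTE.
Qed.

(** Position [p] lies beyond the start of the last edge, so no edge is entered there. *)
Lemma window_sum_loss d r len f j p : 0 < d -> j < len -> 0 < r ->
  p = j * d + r -> (len.-1 * d < p) ->
  window_sum d r len f p.-1 = window_sum d r len f p + f j.
Proof.
move=> d0 jl r0 pE lp; have := window_sum_step d r len f p.-1.
rewrite prednK; last by lia.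
rewrite [X in _ = _ + X]big_pred0 ?addn0; last first.
  move=> i; apply/negbTE; rewrite neq_ltn (leq_ltn_trans _ lp) //.
  by rewrite leq_mul2r -ltnS (ltn_predK jl) ltn_ord orbT.
move=> <-; congr (_ + _).
rewrite -(@sum_eq_mul d len) //; apply: eq_bigl => i.
by rewrite pE eqn_add2r.
Qed.

Lemma window_sum_shift d k len f q : 0 < d -> 0 < k <= q -> q < len ->
  window_sum d (k * d) len f (q * d) + f (q - k) =
  window_sum d (k * d) len f (q * d).-1 + f q.
Proof.
move=> d0 /andP[k0 kq] ql; have := window_sum_step d (k * d) len f (q * d).-1.
have q0 : 0 < q by lia.
rewrite prednK ?muln_gt0 ?q0 // (sum_eq_mul _ d0 ql) => <-; congr (_ + _).
have lqk : q - k < len by lia.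
rewrite -(@sum_eq_mul d len _ (q - k)) //; apply: eq_bigl => i.
by rewrite -mulnDl !eqn_pmul2r // -{2}(subnK kq) eqn_add2r.
Qed.

(** When [d] divides the edge size, sums are constant on blocks of [d] positions, which reduces
    everything to step 1. *)
Lemma window_sum_div d k len f p : 0 < d ->
  window_sum d (k * d) len f p = window_sum 1 k len f (p %/ d).
Proof.
move=> d0; apply: eq_bigl => j.
by rewrite -mulnDl muln1 leq_divRL // ltn_divLR.
Qed.

Lemma window_sum1E k len (f : nat -> nat) b : b < len ->
  window_sum 1 k len f b = \sum_(b.+1 - k <= j < b.+1) f j.
Proof.
move=> bl; rewrite (@big_nat_widen _ _ _ _ _ len) // big_geq_mkord.
by apply: eq_bigl => j; lia.
Qed.

Lemma window_sum_first len (f : nat -> nat) : 0 < len -> window_sum 1 2 len f 0 = f 0.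
Proof.
by move=> l0; rewrite /window_sum (big_pred1 (Ordinal l0)) // => -[[|b] hb];
  rewrite /= -val_eqE /=; lia.
Qed.

Lemma window_sum_last len (f : nat -> nat) : 0 < len ->
  window_sum 1 2 len f len = f len.-1.
Proof.
move=> l0; have hl : len.-1 < len by rewrite prednK.
rewrite /window_sum (big_pred1 (Ordinal hl)) // => -[b hb].
rewrite /= -val_eqE /=; lia.
Qed.

Lemma window_sum_inner len (f : nat -> nat) b : 0 < b < len ->
  window_sum 1 2 len f b = f b.-1 + f b.
Proof.
move=> /andP[b0 bl]; rewrite window_sum1E //.
rewrite (_ : b.+1 - 2 = b.-1); last by lia.
by rewrite big_nat_recr ?leq_pred //= -{2}(prednK b0) big_nat1.
Qed.

Lemma ltn_sum_cond (I : finType) (P : pred I) (i : I) (F G : I -> nat) :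
  P i -> (forall a, P a -> F a < G a) -> \sum_(a | P a) F a < \sum_(a | P a) G a.
Proof.
move=> Pi FG; rewrite (bigD1 i) //= [X in _ < X](bigD1 i) //= -addSn.
by rewrite leq_add ?FG // leq_sum // => a /andP[/FG/ltnW].
Qed.

(** * Reduction of the theta hypergraph to numerical vertex sums *)

Section Reduction.
Variables (r t s : nat) (l : 'I_s -> nat).
Hypotheses (t_gt0 : 0 < t) (t_ltr : t < r).
Hypothesis t_le : forall i, t <= l i * (r - t).

Local Notation d := (r - t).
Local Notation vT := (paths_vertex r t l).

Let d_gt0 : 0 < d. Proof. by rewrite subn_gt0. Qed.
Let l_gt0 i : 0 < l i.
Proof. by case: (l i) (t_le i) => //; rewrite mul0n leqNgt t_gt0. Qed.

(* Complete invariant of the identification: 0 tags the x_j, 1 tags the y_j,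
   and i.+2 the inner vertices of the i-th path. *)
Definition place (i : 'I_s) (p : nat) : nat * nat :=
  if p < t then (0, p)
  else if l i * d <= p then (1, p - l i * d) else (i.+2, p).

Definition vplace (u : vT) : nat * nat := place (tag u) (tagged u).

Lemma identified_vplace u v : identified u v -> vplace u = vplace v.
Proof.
case: u v => [i p] [i' p'] /existsP[j] /=; rewrite /vplace /place /=.
have := t_le i; have := t_le i'; have := ltn_ord j.
move=> jt hi hi' /orP[] /andP[/eqP -> /eqP ->]; first by rewrite jt.
have far a : t <= l a * d -> (l a * d + j < t) = false by lia.
by rewrite !far // !leq_addr !addKn.
Qed.

(** Vertices with equal place are equal or identified in a single step, so no longer chains are
    needed. *)
Lemma vplace_connect u v :
  vplace u = vplace v -> connect (@identified r t s l) u v.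
Proof.
case: u v => [i p] [i' p']; rewrite /vplace /place /=.
have lp := ltn_ord p; have lp' := ltn_ord p'.
case: (ltnP p t) => pt; case: (ltnP p' t) => pt'; last 1 first.
- case: leqP => pl; case: leqP => pl' // [].
    move=> e; apply: connect1; apply/existsP.
    have h : p - l i * d < t by move: lp pl; rewrite /=; lia.
    exists (Ordinal h) => /=; apply/orP; right.
    by rewrite {2}e !subnKC // !eqxx.
  move=> /ord_inj e; case: i' / e p' lp' pt' pl' => p' _ _ _ /ord_inj ->.
  exact: connect0.
- case=> e; apply: connect1; apply/existsP; exists (Ordinal pt) => /=.
  by rewrite e !eqxx.
- by case: leqP.
- by case: leqP.
Qed.

(** Taking [p] as a plain number spares ordinal casts; beyond the end of the path the set is
    empty. *)
Definition vtx (i : 'I_s) (p : nat) : {set vT} := [set v | vplace v == place i p].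

Lemma vertex_classE u : vertex_class u = vtx (tag u) (tagged u).
Proof.
apply/setP => v; rewrite !inE -/(vplace u); apply/idP/eqP; last first.
  by move=> e; apply: vplace_connect.
move=> uv; have cl : closed (@identified r t s l) [pred x | vplace x == vplace u].
  by move=> x y /identified_vplace xy; rewrite !inE xy.
by have := closed_connect cl uv; rewrite !inE eqxx => /esym/eqP.
Qed.

(** The bound on [p] makes the class nonempty, and any member reveals its place. *)
Lemma eq_vtx i p i' p' :
  p < t + l i * d -> vtx i p = vtx i' p' -> place i p = place i' p'.
Proof.
move=> lp e; apply/eqP.
pose u : path_vertex r t (l i) := Ordinal lp.
have : Tagged (fun i => path_vertex r t (l i)) u \in vtx i p.
  by rewrite inE /vplace eqxx.
by rewrite e inE.
Qed.

Lemma place_inj i p q : place i p = place i q -> p = q.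
Proof.
rewrite /place; have := t_le i.
by case: (ltnP p t) => ?; case: (ltnP q t) => ?;
  case: (leqP (l i * d) p) => ?; case: (leqP (l i * d) q) => ? ? // [] ?; lia.
Qed.

Definition path_edge (i : 'I_s) (j : nat) : {set {set vT}} :=
  [set vtx i p | p : 'I_(t + l i * d) & j * d <= p < j * d + r].

Lemma edge_bound i j p : j < l i -> p < j * d + r -> p < t + l i * d.
Proof.
move=> jl pj; have : j.+1 * d <= l i * d by rewrite leq_mul2r jl orbT.
rewrite mulSn; lia.
Qed.

Lemma mem_path_edge i j v : j < l i ->
  reflect (exists2 p, j * d <= p < j * d + r & v = vtx i p) (v \in path_edge i j).
Proof.
move=> jl; apply: (iffP imsetP) => [[p]|[p hp ->]].
  by rewrite inE => hp ->; exists p.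
have hb : p < t + l i * d by apply: edge_bound jl _; case/andP: hp.
by exists (Ordinal hb); rewrite ?inE.
Qed.

(* Paths with [l i * d = t] have no inner vertex, so they all have the same
   edges: only the first of them is kept. *)
Definition representative (i : 'I_s) : bool :=
  [forall a : 'I_s, (l i * d == t) && (l a * d == t) ==> (i <= a)].

Lemma representative_exists i :
  exists2 a, representative a & l a = l i /\ path_edge a =1 path_edge i.
Proof.
case: (boolP (representative i)) => [ri|]; first by exists i.
case/forallPn => b; rewrite negb_imply => /andP[/andP[/eqP hi _] _].
have hi' : l i * d == t by apply/eqP.
case: (@arg_minnP _ i (fun a => l a * d == t) (@nat_of_ord s) hi') => a /eqP ha amin.
exists a; first by apply/forallP => c; apply/implyP => /andP[_ /amin].
have la : l a = l i.
  by apply/eqP; rewrite -(eqn_pmul2r d_gt0) ha hi.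
split=> // j; rewrite /path_edge la; apply: eq_imset => p.
have place_eq q : place a q = place i q.
  by rewrite /place hi ha; case: ltnP => // ->.
by apply/setP => v; rewrite !inE place_eq.
Qed.

(** An inner vertex determines the path, [representative] settles paths without inner vertices, and
    the first position determines the index. *)
Lemma path_edge_inj i j a b :
  representative i -> representative a -> j < l i -> b < l a ->
  path_edge i j = path_edge a b -> i = a /\ j = b.
Proof.
move=> ri ra jl bl e.
(* The position [maxn t (j' * d)] is an inner vertex of the edge, and its place records the path. *)
have inner i' j' a' b' : j' < l i' -> b' < l a' -> t < l i' * d ->
    path_edge i' j' = path_edge a' b' -> i' = a'.
  move=> jl' bl' h e'.
  have h1 : j' * d < l i' * d by rewrite ltn_mul2r d_gt0.
  have : vtx i' (maxn t (j' * d)) \in path_edge i' j'.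
    apply/mem_path_edge => //; exists (maxn t (j' * d)) => //.
    rewrite leq_maxr; lia.
  rewrite e' => /(mem_path_edge _ bl')[q _] /eq_vtx -/(_ ltac:(lia)).
  rewrite /place ltnNge leq_maxl /= leqNgt gtn_max h h1 /=.
  by case: ltnP => // _; case: leqP => // _ [] /ord_inj.
have ia : i = a.
  have := t_le i; rewrite leq_eqVlt => /orP[/eqP hi|hi]; last exact: inner hi e.
  have := t_le a; rewrite leq_eqVlt => /orP[/eqP ha|ha]; last first.
    by apply/esym; apply: inner ha (esym e).
  apply: ord_inj; apply/eqP; rewrite eqn_leq.
  move/forallP: ri => /(_ a); rewrite -hi -ha eqxx /= => ->.
  by move/forallP: ra => /(_ i); rewrite -hi -ha eqxx.
split=> //; case: a / ia {ra} bl e => bl e.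
(* The first position of edge [j1] lies in edge [j2], which therefore starts no later; symmetry
   gives equality. *)
have le j1 j2 : j1 < l i -> j2 < l i -> path_edge i j1 = path_edge i j2 -> j2 <= j1.
  move=> h1 h2 e'.
  have : vtx i (j1 * d) \in path_edge i j1.
    by apply/mem_path_edge => //; exists (j1 * d) => //; lia.
  rewrite e' => /(mem_path_edge _ h2)[q /andP[hq _]] /eq_vtx e2.
  have {}e2 : place i (j1 * d) = place i q.
    by apply: e2; apply: (@edge_bound _ j1) => //; lia.
  by move: hq; rewrite -(place_inj e2) leq_pmul2r.
by apply/eqP; rewrite eqn_leq (le _ _ bl jl (esym e)) (le _ _ jl bl e).
Qed.

(** Restricted to representative paths, slots are in bijection with the edges, which turns edge sums
    into double sums. *)
Definition slot : finType := {i : 'I_s & 'I_(l i)}.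
Definition slot_edge (u : slot) := path_edge (tag u) (tagged u).

Lemma edges_theta :
  edges (theta r t l) =
  [set slot_edge u | u : slot in [pred u : slot | representative (tag u)]].
Proof.
apply/setP => e; apply/bigcupP/imsetP => [[i _]|[[i j] ri ->]].
  case/imsetP => _ /imsetP[j _ ->] ->.
  have [a ra [la ea]] := representative_exists i.
  have jl : j < l a by rewrite la.
  exists (Tagged (fun i => 'I_(l i)) (Ordinal jl)); first by rewrite inE.
  rewrite /slot_edge /= ea.
  apply/setP => v; apply/imsetP/imsetP => [[p hp ->]|[p hp ->]]; exists p;
    rewrite ?vertex_classE //; by move: hp; rewrite !inE.
exists i => //; apply/imsetP; exists (tight_path_edge r t j).
  exact: imset_f.
rewrite /slot_edge /=.
apply/setP => v; apply/imsetP/imsetP => [[p hp ->]|[p hp ->]]; exists p;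
    rewrite ?vertex_classE //; by move: hp; rewrite !inE.
Qed.

Lemma path_edge_in i j :
  representative i -> j < l i -> path_edge i j \in edges (theta r t l).
Proof.
move=> ri jl; rewrite edges_theta; apply/imsetP.
by exists (Tagged (fun i => 'I_(l i)) (Ordinal jl)); rewrite ?inE.
Qed.

Lemma edge_sumE (w : {set {set vT}} -> nat) v :
  edge_sum (theta r t l) w v =
  \sum_(i | representative i) \sum_(j < l i | v \in path_edge i j)
    w (path_edge i j).
Proof.
rewrite /edge_sum edges_theta big_imset_cond /=; last first.
  move=> [i j] [a b]; rewrite !inE /slot_edge /= => ri ra e.
  have [ia jb] := path_edge_inj ri ra (ltn_ord j) (ltn_ord b) e.
  by case: a / ia b {ra e} jb => b /ord_inj ->.
by rewrite (sig_big_dep _ (fun i (j : 'I_(l i)) => v \in path_edge i j)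
   (fun i (j : 'I_(l i)) => w (path_edge i j))).
Qed.

(** Numerical form of [edge_sum]: the shared vertices collect from all representative paths, aligned
    at their starts for the [x_j] and at their ends for the [y_j]. *)
Definition vertex_sum (f : 'I_s -> nat -> nat) (i : 'I_s) (p : nat) : nat :=
  if p < t then \sum_(a | representative a) window_sum d r (l a) (f a) p
  else if l i * d <= p then
    \sum_(a | representative a)
      window_sum d r (l a) (f a) (l a * d + (p - l i * d))
  else window_sum d r (l i) (f i) p.

Lemma mem_path_edge_place i j p i' p' : j < l i -> p < t + l i * d ->
  place i p = place i' p' ->
  (vtx i' p' \in path_edge i j) = (j * d <= p < j * d + r).
Proof.
move=> jl pb e; have -> : vtx i' p' = vtx i p by rewrite /vtx e.
apply/mem_path_edge/idP => // [[q hq /eq_vtx e']|]; last by exists p.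
by rewrite (place_inj (e' _)).
Qed.

Lemma edge_sum_vtx (w : {set {set vT}} -> nat) (f : 'I_s -> nat -> nat) i p :
  representative i -> p < t + l i * d ->
  (forall a j, representative a -> j < l a -> w (path_edge a j) = f a j) ->
  edge_sum (theta r t l) w (vtx i p) = vertex_sum f i p.
Proof.
move=> ri pb wf; rewrite edge_sumE /vertex_sum.
have eqw a q : representative a -> q < t + l a * d -> place a q = place i p ->
  \sum_(j < l a | vtx i p \in path_edge a j) w (path_edge a j) =
  window_sum d r (l a) (f a) q.
  move=> ra qb e; apply: eq_big => [j|j _]; last exact: wf.
  exact: mem_path_edge_place.
case: ltnP => pt.
  apply: eq_bigr => a ra; apply: eqw => //; last by rewrite /place pt.
  exact: (leq_trans pt (leq_addr _ _)).
case: leqP => pl.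
  apply: eq_bigr => a ra; apply: eqw => //; first by lia.
  rewrite /place [p < t]ltnNge pt pl /= ltnNge (leq_trans (t_le a)) ?leq_addr //=.
  by rewrite addKn.
rewrite (bigD1 i) //= (eqw i p) // big1 ?addn0 // => a /andP[ra ai].
rewrite big_pred0 // => j; apply/negP => /mem_path_edge -/(_ (ltn_ord j))[q _].
move=> /eq_vtx -/(_ pb); rewrite /place ltnNge pt leqNgt pl /=.
case: ltnP => // _; case: leqP => // _ [] /ord_inj e.
by rewrite e eqxx in ai.
Qed.

Lemma theta_weightableP m :
  edge_weightable (theta r t l) m <->
  exists f : 'I_s -> nat -> nat,
    (forall i j, representative i -> j < l i -> 1 <= f i j <= m) /\
    (forall i j, representative i -> j < l i -> exists p q,
      [/\ j * d <= p < j * d + r, j * d <= q < j * d + r &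
          vertex_sum f i p <> vertex_sum f i q]).
Proof.
split=> [[w [wb wp]]|[f [fb fp]]].
  exists (fun i j => w (path_edge i j)); split=> i j ri jl.
    exact/wb/path_edge_in.
  have [_ [_ [/(mem_path_edge _ jl)[p hp ->] /(mem_path_edge _ jl)[q hq ->]]]] :=
    wp _ (path_edge_in ri jl).
  rewrite !(@edge_sum_vtx w (fun i j => w (path_edge i j))) //; last first.
  - by apply: edge_bound jl _; case/andP: hp.
  - by apply: edge_bound jl _; case/andP: hq.
  by exists p, q.
(* The slot of an edge is unique by [path_edge_inj]; off the edges 1 is an arbitrary default. *)
pose w e := if [pick u : slot | representative (tag u) && (slot_edge u == e)]
            is Some u then f (tag u) (tagged u) else 1.
have wE a j : representative a -> j < l a -> w (path_edge a j) = f a j.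
  move=> ra jl; rewrite /w; case: pickP => [[b k] /= /andP[rb /eqP e]|].
    have [ba <-] := path_edge_inj rb ra (ltn_ord k) jl e.
    by case: a / ba {ra jl e}.
  by move/(_ (Tagged (fun i => 'I_(l i)) (Ordinal jl))); rewrite /= ra eqxx.
exists w; split=> e; rewrite edges_theta => /imsetP[[i j]]; rewrite inE => ri ->.
  by rewrite wE ?fb.
have jl := ltn_ord j.
have [p [q [hp hq ne]]] := fp i j ri jl.
exists (vtx i p), (vtx i q); split.
- by apply/mem_path_edge => //; exists p.
- by apply/mem_path_edge => //; exists q.
rewrite !(@edge_sum_vtx w f) //.
- by apply: edge_bound jl _; case/andP: hq.
- by apply: edge_bound jl _; case/andP: hp.
Qed.

(** * Positions where a vertex sum strictly changes *)

Section Positive.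
Variable f : 'I_s -> nat -> nat.
Hypothesis f_gt0 : forall i j, 0 < f i j.

(** No edge is left at [j * d]. Below [t] every path gains its edge [j], beyond [t] only the own
    path does; at [t] itself the other paths would drop out. *)
Lemma vertex_sum_gain i j : representative i -> 0 < j < l i -> j * d != t ->
  (forall a, a * d + r != j * d) ->
  vertex_sum f i (j * d).-1 < vertex_sum f i (j * d).
Proof.
move=> ri /andP[j0 jl] jt nr; have jd0 : 0 < j * d by rewrite muln_gt0 j0.
have jld : j * d < l i * d by rewrite ltn_pmul2r.
rewrite /vertex_sum.
case: (ltnP (j * d) t) => h; last first.
  rewrite (_ : (j * d).-1 < t = false); last by lia.
  rewrite (_ : l i * d <= (j * d).-1 = false); last by lia.
  rewrite (_ : l i * d <= j * d = false) ?window_sum_gain ?j0 //; last by lia.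
  by rewrite -[ltnLHS]addn0 ltn_add2l.
have -> : (j * d).-1 < t by lia.
apply: (ltn_sum_cond ri) => a ra; rewrite (@window_sum_gain d r (l a)) //.
  by rewrite -[ltnLHS]addn0 ltn_add2l.
by rewrite j0 -(ltn_pmul2r d_gt0) (leq_trans h).
Qed.

Lemma vertex_sum_loss i j : representative i -> 0 < j < l i ->
  l i * d < j * d + t ->
  vertex_sum f i (j * d + t) < vertex_sum f i (j * d + t).-1.
Proof.
move=> ri /andP[j0 jl] h; have := t_le i => ti; rewrite /vertex_sum.
rewrite (_ : j * d + t < t = false); last by lia.
rewrite (_ : (j * d + t).-1 < t = false); last by lia.
rewrite (ltnW h) (_ : l i * d <= (j * d + t).-1) /=; last by lia.
apply: (ltn_sum_cond ri) => a ra.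
have -> : l a * d + ((j * d + t).-1 - l i * d) = (l a * d + (j * d + t - l i * d)).-1.
  by lia.
have ta := t_le a.
(* Index on path [a] at the same distance from the end as [j] on path [i]; edge [b.-1] is the one
   left there. *)
pose b := l a - (l i - j).
have lid : (l i - j) * d < t by rewrite mulnBl; lia.
have lij : l i - j < l a by rewrite -(ltn_pmul2r d_gt0); lia.
have ba : b < l a by rewrite /b; lia.
have b0 : 0 < b by rewrite /b; lia.
have pE : l a * d + (j * d + t - l i * d) = b.-1 * d + r.
  have bd : b.-1 * d + d = b * d by rewrite addnC -mulSn prednK.
  have bE : b * d = l a * d - (l i * d - j * d) by rewrite !mulnBl.
  lia.
rewrite (@window_sum_loss d r (l a) (f a) b.-1 _) //; last 3 first.
- by lia.
- by lia.
- have : (l a).-1 * d <= l a * d by rewrite leq_pmul2r // leq_pred.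
  lia.
by rewrite -[ltnLHS]addn0 ltn_add2l.
Qed.

End Positive.

Lemma weightable_gt0 (i : 'I_s) m : edge_weightable (theta r t l) m -> 0 < m.
Proof.
move/theta_weightableP => [f [fb _]].
have [a ra [la _]] := representative_exists i.
by case/andP: (fb a 0 ra (l_gt0 a)) => /leq_trans h /h.
Qed.

(** * The cases t < r/2, and t > r/2 with r - t not dividing r *)

Lemma chi_e1 (i0 : 'I_s) :
  (forall i j, representative i -> j < l i -> exists p q,
      [/\ j * d <= p < j * d + r, j * d <= q < j * d + r &
          vertex_sum (fun _ _ => 1) i p <> vertex_sum (fun _ _ => 1) i q]) ->
  chi_e_is (theta r t l) 1.
Proof.
move=> h; split; last by move=> m; apply: weightable_gt0.
by apply/theta_weightableP; exists (fun _ _ => 1).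
Qed.

(** Position [j * d + t] lies in edge [j] alone, while [j * d] also lies in edge [j.-1] or, for
    [j = 0], is an end shared by all paths. *)
Lemma chi_theta_lt_half : 3 <= s -> 2 * t < r -> chi_e_is (theta r t l) 1.
Proof.
move=> s3 tr; have ri i : representative i.
  apply/forallP => a; apply/implyP => /andP[/eqP e _].
  have : 1 * d <= l i * d by rewrite leq_pmul2r.
  lia.
apply: (chi_e1 (Ordinal s3)) => i j _ jl.
have jld : j.+1 * d <= l i * d by rewrite leq_pmul2r.
rewrite mulSn in jld.
exists (j * d + t), (j * d); split; try by lia.
have -> : vertex_sum (fun _ _ => 1) i (j * d + t) = 1.
  rewrite /vertex_sum (_ : j * d + t < t = false); last by lia.
  rewrite (_ : l i * d <= j * d + t = false); last by lia.
  rewrite /window_sum (big_pred1 (Ordinal jl)) // => b; rewrite /= -val_eqE /=.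
  case: (ltngtP b j) => /= bj.
  - have : b.+1 * d <= j * d by rewrite leq_pmul2r.
    rewrite mulSn; lia.
  - have : j.+1 * d <= b * d by rewrite leq_pmul2r.
    rewrite mulSn; lia.
  - rewrite bj; lia.
suff : 1 < vertex_sum (fun _ _ => 1) i (j * d) by lia.
case: (posnP j) => [->|j0].
  rewrite /vertex_sum mul0n t_gt0 (leq_trans (ltnW s3)) //.
  rewrite -[leqLHS]card_ord -sum1_card [leqRHS](eq_bigl xpredT) // leq_sum // => a _.
  by apply: (leq_window_sum (fun _ => 1) (l_gt0 a)); rewrite mul0n; lia.
have jd : d <= j * d by rewrite -[leqLHS]mul1n leq_pmul2r.
rewrite /vertex_sum (_ : j * d < t = false); last by lia.
rewrite (_ : l i * d <= j * d = false); last by lia.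
have jE : j.-1 * d + d = j * d by rewrite addnC -mulSn prednK.
apply: (@leq_window_sum2 d r (l i) (fun _ => 1) _ j j.-1); lia.
Qed.

(** An edge that is not the last of its path contains the start of the next one, where the sum grows
    because nothing ends there. On the last edge, edge [j.-1] is left among the [y] vertices and the
    sum drops. *)
Lemma chi_theta_ndvd (i0 : 'I_s) :
  r < 2 * t -> ~~ (d %| r) -> chi_e_is (theta r t l) 1.
Proof.
move=> tr ndvd; apply: (chi_e1 i0) => i j ri jl.
have rE : r = d + t by lia.
have ndt : ~~ (d %| t).
  by apply: contra ndvd => h; rewrite [X in _ %| X]rE dvdn_addr.
case: (ltnP j.+1 (l i)) => h.
  exists (j.+1 * d).-1, (j.+1 * d); split; rewrite ?mulSn; try by lia.
  suff : vertex_sum (fun _ _ => 1) i (j.+1 * d).-1 <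
         vertex_sum (fun _ _ => 1) i (j.+1 * d) by rewrite mulSn; lia.
  apply: vertex_sum_gain => // [|a].
    by apply: contra ndt => /eqP e; rewrite -[X in _ %| X]e dvdn_mull.
  apply: contra ndvd => /eqP e.
  by rewrite -(@dvdn_addr (a * d)) ?dvdn_mull // e dvdn_mull.
have lE : l i = j.+1 by lia.
have j0 : 0 < j.
  case: (posnP j) => // j0; have := t_le i; rewrite lE j0 mul1n; lia.
exists (j * d + t), (j * d + t).-1; split; try by lia.
suff : vertex_sum (fun _ _ => 1) i (j * d + t) <
       vertex_sum (fun _ _ => 1) i (j * d + t).-1 by lia.
by apply: vertex_sum_loss; rewrite ?j0 // lE mulSn; lia.
Qed.

(** * The case t > r/2 with r = k(r - t) *)

Section Divisible.
Variable k : nat.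
Hypotheses (k_ge3 : 3 <= k) (r_dvd : r = k * d).

Let t_eq : t = k.-1 * d. Proof. by rewrite -subn1 mulnBl -r_dvd mul1n; lia. Qed.
Let mul_lt_t a : (a * d < t) = (a < k.-1).
Proof. by rewrite [in ltnRHS]t_eq ltn_pmul2r. Qed.
Let t_lt_mul a : (t < a * d) = (k.-1 < a).
Proof. by rewrite [in ltnLHS]t_eq ltn_pmul2r. Qed.
Let k_le i : k.-1 <= l i.
Proof. by have := t_le i; rewrite [in leqLHS]t_eq leq_pmul2r. Qed.

Section UniformBound.
Variable f : 'I_s -> nat -> nat.
Hypothesis f_gt0 : forall i j, 0 < f i j.
(** With these two bounds, what a single other path contributes at an end already exceeds the weight
    that the own path gains or loses there. *)
Hypothesis start_gt :
  forall i a, f i (k.-1) < window_sum d r (l a) (f a) t.-1.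
Hypothesis end_gt : forall i a, k <= l i ->
  f i (l i - k) < window_sum d r (l a) (f a) (l a * d).

(* From position t-1 to t the own path gains the edge k-1, while the other paths
   contribute at t-1 only. *)
Lemma vertex_sum_start i : representative i -> k <= l i ->
  vertex_sum f i t.-1 <> vertex_sum f i t.
Proof.
move=> ri kl; rewrite /vertex_sum ltnn (_ : t.-1 < t) /=; last by lia.
have tl : t < l i * d by rewrite t_lt_mul; lia.
rewrite leqNgt tl /= (bigD1 i) //=.
have := @window_sum_gain d r (l i) (f i) k.-1 d_gt0 ltac:(lia).
rewrite -t_eq => -> => [|a]; last first.
  by rewrite [X in _ + X]r_dvd [X in _ != X]t_eq -mulnDl eqn_pmul2r //; lia.
move/addnI; case: (pickP (fun a => representative a && (a != i))) => [a ha|h0].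
  rewrite (bigD1 a) //= => e.
  have := start_gt i a; rewrite -e; lia.
by rewrite big_pred0 // => e; have := f_gt0 i k.-1; rewrite -e.
Qed.

(** Mirror image of [vertex_sum_start]: the own path loses edge [l i - k] while the other paths
    begin to contribute. *)
Lemma vertex_sum_end i : representative i -> k <= l i ->
  vertex_sum f i (l i * d).-1 <> vertex_sum f i (l i * d).
Proof.
move=> ri kl.
have kld : k * d <= l i * d by rewrite leq_pmul2r.
rewrite /vertex_sum leqnn subnn (_ : l i * d < t = false); last first.
  by rewrite ltnNge t_le.
rewrite (_ : (l i * d).-1 < t = false); last by lia.
rewrite (_ : l i * d <= (l i * d).-1 = false); last by lia.
rewrite [in RHS](bigD1 i) //= addn0.
rewrite (@window_sum_loss d r (l i) (f i) (l i - k) (l i * d)) //; last 4 first.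
- by lia.
- by lia.
- by rewrite [X in _ + X]r_dvd -mulnDl subnK.
- by rewrite ltn_pmul2r //; lia.
move/addnI; case: (pickP (fun a => representative a && (a != i))) => [a ha|h0].
  rewrite (bigD1 a) //= addn0 => e.
  have := end_gt a kl; rewrite e; lia.
by rewrite big_pred0 // => e; have := f_gt0 i (l i - k); rewrite e.
Qed.

(** Edges near an end contain a monotone step or a transition between shared and inner vertices. For
    the remaining ones, passing [q * d] exchanges edge [q - k] for edge [q]. *)
Lemma dvd_proper i j : representative i -> j < l i ->
  (k.-1 <= j <= l i - k -> k <= l i ->
     exists q, j < q < j + k /\ f i q <> f i (q - k)) ->
  exists p q, [/\ j * d <= p < j * d + r, j * d <= q < j * d + r &
                  vertex_sum f i p <> vertex_sum f i q].
Proof.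
move=> ri jl mid; have kl := k_le i.
have jld : j.+1 * d <= l i * d by rewrite leq_pmul2r.
case: (ltnP j.+1 k.-1) => h1.
  exists (j.+1 * d).-1, (j.+1 * d); split; rewrite ?mulSn; try by lia.
  have h2 : j.+1 * d < t by rewrite mul_lt_t.
  suff : vertex_sum f i (j.+1 * d).-1 < vertex_sum f i (j.+1 * d).
    by rewrite mulSn; lia.
  by apply: vertex_sum_gain => // [||a]; lia.
case: (ltnP (l i) (j + k.-1)) => h2.
  exists (j * d + t), (j * d + t).-1; split; try by lia.
  have h3 : l i * d < j * d + t by rewrite [X in _ + X]t_eq -mulnDl ltn_pmul2r.
  have := @vertex_sum_loss f f_gt0 i j ri; rewrite jl andbT => /(_ ltac:(lia)); lia.
have kl' : k <= l i by lia.
case: (ltngtP j.+1 k.-1) => h3; first by lia.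
  case: (ltngtP (l i) (j + k.-1)) => h4; first by lia.
    have [q [hq ne]] := mid ltac:(lia) kl'.
    have q1 : j.+1 * d <= q * d by rewrite leq_pmul2r //; lia.
    have q2 : q * d < (j + k) * d by rewrite ltn_pmul2r //; lia.
    have q3 : q * d < l i * d by rewrite ltn_pmul2r //; lia.
    have q4 : k * d <= q * d by rewrite leq_pmul2r //; lia.
    rewrite mulSn mulnDl in q1 q2.
    exists (q * d), (q * d).-1; split; try by lia.
    rewrite /vertex_sum (_ : q * d < t = false); last by lia.
    rewrite (_ : (q * d).-1 < t = false); last by lia.
    rewrite (_ : l i * d <= q * d = false); last by lia.
    rewrite (_ : l i * d <= (q * d).-1 = false); last by lia.
    have := @window_sum_shift d k (l i) (f i) q d_gt0 ltac:(lia) ltac:(lia).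
    rewrite -r_dvd; lia.
  exists (l i * d).-1, (l i * d); split; last exact: vertex_sum_end.
    by rewrite h4 mulnDl -t_eq; lia.
  by rewrite h4 mulnDl -t_eq; lia.
have tj : t = d + j * d by rewrite [LHS]t_eq -h3 mulSn.
exists t.-1, t; split; last exact: vertex_sum_start.
  by lia.
by lia.
Qed.

End UniformBound.

(** Since [k >= 3], [t] is at least [2 * d], so edges 0 and 1 both reach position [t.-1]. *)
Lemma leq_start_sum (f : nat -> nat) a :
  f 0 + f 1 <= window_sum d r (l a) f t.-1.
Proof.
have := k_le a; have t2 : 2 * d <= t.
  by rewrite [in leqRHS]t_eq leq_pmul2r //; lia.
by move=> la; apply: leq_window_sum2; lia.
Qed.

Lemma leq_end_sum (f : nat -> nat) a j j' : j != j' ->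
  l a < j + k -> j < l a -> l a < j' + k -> j' < l a ->
  f j + f j' <= window_sum d r (l a) f (l a * d).
Proof.
have inw i : l a < i + k -> i < l a -> i * d <= l a * d < i * d + r.
  by move=> ? ?; rewrite [X in _ + X]r_dvd -mulnDl ltn_pmul2r // leq_pmul2r //; lia.
by move=> jj' hj jl hj' jl'; apply: leq_window_sum2; rewrite ?inw.
Qed.

(** For such lengths the middle range [k.-1 <= j <= l i - k] of [dvd_proper] is empty. *)
Lemma chi_theta_short (i0 : 'I_s) :
  (forall i, l i <= 2 * (k - 1)) -> chi_e_is (theta r t l) 1.
Proof.
move=> short; apply: (chi_e1 i0) => i j ri jl.
apply: dvd_proper => //.
- by move=> _ a; have := leq_start_sum (fun _ => 1) a.
- move=> _ a _; have := k_le a => la.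
  apply: (@leq_end_sum (fun _ => 1) a (l a - 1) (l a - 2)); lia.
have := short i; lia.
Qed.

(* Among any k-1 consecutive q there is a multiple of k-1, and then q - k is not
   one: the edges entered and left at q have different weights. *)
Definition comb (j : nat) : nat := if k.-1 %| j then 2 else 1.

Lemma comb_gt0 j : 0 < comb j.
Proof. by rewrite /comb; case: ifP. Qed.

Lemma comb_le2 j : comb j <= 2.
Proof. by rewrite /comb; case: ifP. Qed.

Lemma theta_weightable2 : edge_weightable (theta r t l) 2.
Proof.
apply/theta_weightableP; exists (fun _ => comb); split=> i j ri jl.
  by rewrite comb_gt0 comb_le2.
have multiple b : exists2 q, b < q <= b + k.-1 & k.-1 %| q.
  exists ((b + k.-1) %/ k.-1 * k.-1); last exact: dvdn_mull.
  have := divn_eq (b + k.-1) k.-1; have := @ltn_pmod (b + k.-1) k.-1; lia.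
apply: dvd_proper => // [_ j'|_ a|i' a la|hj kl].
- exact: comb_gt0.
- apply: leq_ltn_trans (comb_le2 _) _.
  apply: leq_trans (leq_start_sum comb a).
  by rewrite {1}/comb dvdn0; have := comb_gt0 1; lia.
- apply: leq_ltn_trans (comb_le2 _) _; have := k_le a => ka.
  (* The last multiple of [k.-1] below [l a] gives an edge of weight 2 at the end; any other edge
     there raises the sum to at least 3. *)
  have [q [hq ql] dq] : exists2 q, l a < q + k /\ q < l a & k.-1 %| q.
    exists ((l a).-1 %/ k.-1 * k.-1); last exact: dvdn_mull.
    have := divn_eq (l a).-1 k.-1; have := @ltn_pmod (l a).-1 k.-1; lia.
  have [q' hq' ne] : exists2 q', l a < q' + k & (q' < l a) && (q != q').
    by case: (eqVneq q (l a - 1)) => e;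
       [exists (l a - 2) | exists (l a - 1)]; lia.
  have {ne} [ql' ne] := andP ne.
  apply: leq_trans (leq_end_sum comb ne hq ql hq' ql').
  by rewrite {1}/comb dq; have := comb_gt0 q'; lia.
have [q hq dq] := multiple j.
exists q; split; first by lia.
rewrite /comb dq; case: ifP => // dqk.
(* If [k.-1] divided both [q] and [q - k], it would divide [k], which is impossible for [k >= 3]. *)
have : k.-1 %| q - k + k.
  by rewrite subnK //; have := dvdn_leq _ dq; lia.
rewrite dvdn_addr // => /dvdnP[c]; case: c => [|[|c]]; rewrite ?mulSn; nia.
Qed.

(** On a long path, edge [k.-1] consists of inner vertices, each in exactly [k] edges, so weight 1
    everywhere makes it monochromatic. *)
Lemma chi_theta_long : (exists i, 2 * (k - 1) < l i) -> chi_e_is (theta r t l) 2.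
Proof.
move=> [i long]; split; first exact: theta_weightable2.
move=> m hm; have m0 := weightable_gt0 i hm; rewrite ltn_neqAle m0 andbT.
apply/eqP => m1; move: hm; rewrite -m1.
move/theta_weightableP => [f [fb fp]].
have ti : t < l i * d by rewrite [in ltnLHS]t_eq ltn_pmul2r //; lia.
have ri : representative i.
  by apply/forallP => a; rewrite (gtn_eqF ti).
have [p [q [hp hq []]]] := fp i k.-1 ri ltac:(lia).
suff const p' : k.-1 * d <= p' < k.-1 * d + r -> vertex_sum f i p' = k.
  by rewrite !const.
move=> hp'; have kd : (2 * k - 1) * d <= l i * d by rewrite leq_pmul2r //; lia.
rewrite mulnBl mul1n -mulnA -r_dvd in kd.
rewrite -t_eq in hp'.
rewrite /vertex_sum (_ : p' < t = false); last by lia.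
rewrite (_ : l i * d <= p' = false); last by lia.
rewrite [X in window_sum _ X]r_dvd window_sum_div //.
have pd : p' %/ d < l i by rewrite ltn_divLR //; lia.
have pk : k.-1 <= p' %/ d by rewrite leq_divRL // -t_eq; lia.
rewrite window_sum1E // (eq_big_nat _ _ (F2 := fun _ => 1)).
  by rewrite sum_nat_const_nat; lia.
move=> j hj; have := fb i j ri; lia.
Qed.

End Divisible.

(** * The case t = r/2 *)

Section Half.
Hypothesis r_half : r = 2 * t.
Hypothesis all_rep : forall i, representative i.

Let d_eq : d = t. Proof. by lia. Qed.

(* Merging the vertices of each block of [t] consecutive positions turns the
   paths into ordinary graph paths with vertices 0, ..., l i. *)
Definition block_sum (f : 'I_s -> nat -> nat) (i : 'I_s) (b : nat) : nat :=
  if b == 0 then \sum_a f a 0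
  else if b < l i then f i b.-1 + f i b else \sum_a f a (l a).-1.

Lemma vertex_sum_block f i p : p < t + l i * d ->
  vertex_sum f i p = block_sum f i (p %/ d).
Proof.
move=> hp; have r2 : r = 2 * d by lia.
rewrite /vertex_sum /block_sum.
have lt_t : (p < t) = (p %/ d == 0).
  by rewrite -leqn0 -[in RHS]ltnS ltn_divLR // mul1n d_eq.
have leq_l : (l i * d <= p) = ~~ (p %/ d < l i) by rewrite -leqNgt leq_divRL.
rewrite lt_t leq_l.
case: (eqVneq (p %/ d) 0) => [p0|p0].
  apply: eq_big => [a|a _]; first exact: all_rep.
  by rewrite [X in window_sum _ X]r2 window_sum_div // p0 window_sum_first.
case: (ltnP (p %/ d) (l i)) => h /=.
  by rewrite [X in window_sum _ X]r2 window_sum_div // window_sum_inner // lt0n p0.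
apply: eq_big => [a|a _]; first exact: all_rep.
rewrite [X in window_sum _ X]r2 window_sum_div // divnMDl // divn_small ?addn0.
  by rewrite window_sum_last.
by rewrite ltn_subLR ?leq_l -?leqNgt //; lia.
Qed.

(** Edge [j] is the union of blocks [j] and [j.+1], and sums are constant on blocks. *)
Lemma half_weightableP m :
  edge_weightable (theta r t l) m <->
  exists f : 'I_s -> nat -> nat,
    (forall i j, j < l i -> 1 <= f i j <= m) /\
    (forall i j, j < l i -> block_sum f i j <> block_sum f i j.+1).
Proof.
have r2 : r = 2 * d by lia.
split=> [/theta_weightableP|] [f [fb fp]].
  exists f; split=> i j jl; first exact: fb.
  have [p [q [hp hq]]] := fp i j (all_rep i) jl.
  rewrite !vertex_sum_block; last 2 first.
  - by apply: edge_bound jl _; case/andP: hq.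
  - by apply: edge_bound jl _; case/andP: hp.
  have block p' : j * d <= p' < j * d + r -> p' %/ d = j \/ p' %/ d = j.+1.
    by rewrite [X in _ + X]r2 -mulnDl -leq_divRL // -ltn_divLR //; lia.
  by case: (block p hp) => ->; case: (block q hq) => -> // ne e;
    apply: ne; rewrite e.
apply/theta_weightableP; exists f; split=> i j _ jl; first exact: fb.
exists (j * d), (j.+1 * d); rewrite mulSn; split; try by lia.
have bj : j * d < t + l i * d by apply: (edge_bound jl); lia.
have bj1 : d + j * d < t + l i * d by apply: (edge_bound jl); lia.
rewrite !vertex_sum_block // -mulSn !mulnK //.
exact: fp.
Qed.

(** Both blocks of an edge count the weight of that edge; cancelling it leaves these conditions. *)
Lemma half_weightable m (f : 'I_s -> nat -> nat) :
  (forall i j, j < l i -> 1 <= f i j <= m) ->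
  (forall i j, j.+2 < l i -> f i j <> f i j.+2) ->
  (forall i, 2 <= l i -> \sum_(a | a != i) f a 0 <> f i 1) ->
  (forall i, 2 <= l i -> \sum_(a | a != i) f a (l a).-1 <> f i (l i).-2) ->
  (forall i, l i = 1 -> \sum_a f a 0 <> \sum_a f a (l a).-1) ->
  edge_weightable (theta r t l) m.
Proof.
move=> fb inner start stop one; apply/half_weightableP.
exists f; split=> // i j jl; rewrite /block_sum /=.
case: (posnP j) => [->|j0] /=.
  case: (ltngtP (l i) 1) => h; first by have := l_gt0 i; lia.
    by rewrite (bigD1 i) //= => /addnI; apply: start.
  exact: (one i h).
rewrite jl; case: (ltnP j.+1 (l i)) => h.
  rewrite addnC => /addnI; have := inner i j.-1; rewrite prednK //.
  by move=> /(_ h).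
have lE : l i = j.+1 by lia.
rewrite [in RHS](bigD1 i) //= lE /= addnC => /addnI e.
by apply: (stop i); rewrite lE //= e.
Qed.

Lemma half_weightable_inner m : edge_weightable (theta r t l) m ->
  exists f : 'I_s -> nat -> nat, [/\
    forall i j, j < l i -> 1 <= f i j <= m,
    forall i j, j.+2 < l i -> f i j <> f i j.+2 &
    forall i, l i = 1 -> \sum_a f a 0 <> \sum_a f a (l a).-1].
Proof.
case/half_weightableP => f [fb fp]; exists f; split=> // [i j jl e|i l1].
  have := fp i j.+1 (ltnW jl).
  by rewrite /block_sum /= jl (ltnW jl) e addnC.
by have := fp i 0; rewrite /block_sum l1 /=; apply.
Qed.

(* The solutions of g j.+2 = 3 - g j, with g 0 = a and g 1 = b. *)
Definition period4 (a b j : nat) : nat :=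
  nth 0 [:: a; b; 3 - a; 3 - b] (j %% 4).

Lemma period4_bound a b j : 1 <= a <= 2 -> 1 <= b <= 2 -> 1 <= period4 a b j <= 2.
Proof.
rewrite /period4; have := @ltn_pmod j 4 isT.
by case: (j %% 4) => [|[|[|[|//]]]] /=; lia.
Qed.

Lemma period4_SS a b j : 1 <= a <= 2 -> 1 <= b <= 2 ->
  period4 a b j <> period4 a b j.+2.
Proof.
rewrite /period4 -(addn2 j) -(modnDml j 2); have := @ltn_pmod j 4 isT.
by case: (j %% 4) => [|[|[|[|//]]]] /=; lia.
Qed.

Lemma period4_last a b n : 2 <= n ->
  period4 a b n.-1 = nth 0 [:: 3 - b; a; b; 3 - a] (n %% 4) /\
  period4 a b n.-2 = nth 0 [:: 3 - a; 3 - b; a; b] (n %% 4).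
Proof.
case: n => [|[|n]] //= _; rewrite /period4.
have -> : n.+1 %% 4 = (n %% 4 + 1) %% 4 by lia.
have -> : n.+2 %% 4 = (n %% 4 + 2) %% 4 by lia.
have := @ltn_pmod n 4 isT.
by case: (n %% 4) => [|[|[|[|//]]]].
Qed.

Lemma sum1_others (i : 'I_s) : \sum_(a | a != i) 1 = s.-1.
Proof. by have := cardC1 i; rewrite card_ord -sum1_card => <-. Qed.

Lemma chi_half_two : 3 <= s -> (forall i, l i = 2) -> chi_e_is (theta r t l) 1.
Proof.
move=> s3 l2; split; last by move=> m; apply: (weightable_gt0 (Ordinal s3)).
apply: (@half_weightable 1 (fun _ _ => 1)) => // [i j|i _|i _|i].
- by rewrite l2.
- rewrite sum1_others; lia.
- rewrite sum1_others; lia.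
- by rewrite l2.
Qed.

Lemma not_weightable1 : (exists i, l i = 1) \/ (exists i, 3 <= l i) ->
  ~ edge_weightable (theta r t l) 1.
Proof.
move=> h /half_weightable_inner[f [fb inner one]].
have f1 i j : j < l i -> f i j = 1 by move/fb; lia.
case: h => [[i l1]|[i l3]].
  apply: (one i l1); apply: eq_bigr => a _.
  by rewrite !f1 ?ltn_predL.
by apply: (inner i 0 l3); rewrite !f1 //; lia.
Qed.

(** At least two other paths contribute at least 1 each, so a total of at most 2 forces all
    contributions to be 1. *)
Lemma sum_other_eq (g : 'I_s -> nat) (i : 'I_s) v : 3 <= s -> v <= 2 ->
  (forall a, 0 < g a) -> \sum_(a | a != i) g a = v ->
  v = 2 /\ (forall a, a != i -> g a = 1).
Proof.
move=> s3 v2 g0 e.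
have c : s.-1 <= \sum_(a | a != i) g a.
  by rewrite -(sum1_others i) leq_sum.
split; first by lia.
move=> a ai; apply/eqP; rewrite eqn_leq g0 andbT leqNgt; apply/negP => ga.
suff : s.-1 < \sum_(a | a != i) g a by lia.
rewrite -(sum1_others i) (bigD1 a) //= [ltnRHS](bigD1 a) //= -addSn leq_add //.
exact: leq_sum.
Qed.

Lemma exists_third (i o : 'I_s) : 3 <= s -> exists2 a, a != i & a != o.
Proof.
move=> s3; have : 0 < #|~: [set i; o]|.
  by have := cardsC [set i; o]; rewrite cards2 card_ord; lia.
by case/card_gt0P => a; rewrite !inE negb_or => /andP[]; exists a.
Qed.

(* The sums at an end fail only as 1 + 1 = 2.  The first weight is 1 only on the
   paths of length 3 mod 4 other than z, the last weight only on z. *)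
Lemma half_weightable2_long : 3 <= s -> (forall i, 2 <= l i) ->
  edge_weightable (theta r t l) 2.
Proof.
move=> s3 l2; pose z := [pick z | l z %% 4 == 3].
pose A i := if (l i %% 4 == 3) && (z != Some i) then 1 else 2.
(* For lengths 2 mod 4 the last weight equals the second one, hence the value 2. *)
pose B i := if l i %% 4 == 2 then 2 else 1.
have hA i : 1 <= A i <= 2 by rewrite /A; case: ifP.
have hB i : 1 <= B i <= 2 by rewrite /B; case: ifP.
pose f i := period4 (A i) (B i).
have fb i j : 1 <= f i j <= 2 by apply: period4_bound.
have f0 i : f i 0 = A i by [].
have f1 i : f i 1 = B i by [].
have zP i : l i %% 4 == 3 -> exists2 y, z = Some y & l y %% 4 == 3.
  by rewrite /z; case: pickP => [y ly _|->] //; exists y.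
apply: (@half_weightable 2 f) => // [i j _|i _ e|i _ e|i l1].
- exact: period4_SS.
- have [b2 a1] := sum_other_eq s3 (proj2 (andP (fb i 1)))
    (fun a => proj1 (andP (fb a 0))) e.
  have only3 a : a != i -> (l a %% 4 == 3) && (z != Some a).
    by move/a1; rewrite f0 /A; case: ifP.
  have [a ai _] := exists_third i i s3.
  case/andP: (only3 a ai) => /zP[y zy y3] _.
  (* So the own path is [z], whose second weight is 1 and not the required 2. *)
  have iy : y = i by apply/eqP; apply: contraT => /only3; rewrite zy eqxx andbF.
  by move: b2; rewrite f1 /B -iy (eqP y3).
- have [_ a1] := sum_other_eq s3 (proj2 (andP (fb i (l i).-2)))
    (fun a => proj1 (andP (fb a (l a).-1))) e.
  have onlyz a : a != i -> z = Some a.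
    move/a1; rewrite /f; have [-> _] := period4_last (A a) (B a) (l2 a).
    have := @ltn_pmod (l a) 4 isT; rewrite /A /B.
    by case: (l a %% 4) => [|[|[|[|//]]]] //=; case: (eqVneq z (Some a)).
  have [a ai _] := exists_third i i s3.
  have [b bi ba] := exists_third i a s3.
  have := onlyz a ai; rewrite (onlyz b bi) => -[e'].
  by rewrite e' eqxx in ba.
- by have := l2 i; rewrite l1.
Qed.

(** Weights in {1,2} that differ at distance 2 repeat at distance 4, so first and last weights agree
    on every path and the single edge of [o] sees equal sums. *)
Lemma not_weightable2 (o : 'I_s) : l o = 1 -> (forall i, i != o -> l i %% 4 = 1) ->
  ~ edge_weightable (theta r t l) 2.
Proof.
move=> l_o l1 /half_weightable_inner[f [fb inner one]].
have per4 i n : 4 * n < l i -> f i (4 * n) = f i 0.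
  elim: n => [|n IH] h; first by rewrite muln0.
  rewrite -IH; last by lia.
  rewrite mulnS addnC.
  have := inner i (4 * n) ltac:(lia); have := inner i (4 * n).+2 ltac:(lia).
  rewrite !addnS addn0.
  have := fb i (4 * n) ltac:(lia); have := fb i (4 * n).+2 ltac:(lia).
  have := fb i (4 * n).+4 ltac:(lia); lia.
apply: (one o l_o); apply: eq_bigr => i _.
have l4 : (l i).-1 = 4 * (l i %/ 4).
  have : l i %% 4 = 1 by case: (eqVneq i o) => [->|/l1//]; rewrite l_o.
  lia.
by rewrite l4 per4 // -l4 ltn_predL.
Qed.

(** * One path of length 1 when t = r/2 *)

Section ShortFirst.
Variable o : 'I_s.
Hypotheses (s_ge3 : 3 <= s) (l_o : l o = 1) (l_other : forall i, i != o -> 2 <= l i).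

(** The edge of [o] has maximal weight and lies at both ends; with a third path it outweighs any
    single weight, which settles the end edges of the other paths. The last two conditions separate
    the two ends for the edge of [o]. *)
Lemma short_weightable m (f : 'I_s -> nat -> nat) :
  (forall i j, 1 <= f i j <= m) ->
  m <= f o 0 ->
  (forall i j, i != o -> j.+2 < l i -> f i j <> f i j.+2) ->
  (forall i, f i (l i).-1 <= f i 0) ->
  (exists i, f i (l i).-1 < f i 0) ->
  edge_weightable (theta r t l) m.
Proof.
move=> fb fo inner le [i0 lt0].
have big g i : (forall a, 0 < g a) -> m <= g o -> i != o ->
    m < \sum_(a | a != i) g a.
  move=> g0 go io; have [a ai ao] := exists_third i o s_ge3.
  rewrite (bigD1 o) //=; last by rewrite eq_sym.
  by rewrite (bigD1 a) ?ai //=; have := g0 a; lia.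
apply: (@half_weightable m f) => // [i j jl|i li|i li|i _].
- apply: inner => //; apply: contraTneq jl => ->; rewrite l_o; lia.
- have io : i != o by apply: contraTneq li => ->; rewrite l_o.
  have := big (fun a => f a 0) i (fun a => proj1 (andP (fb a 0))) fo io.
  have := fb i 1; lia.
- have io : i != o by apply: contraTneq li => ->; rewrite l_o.
  have := big (fun a => f a (l a).-1) i (fun a => proj1 (andP (fb a _))).
  rewrite l_o => /(_ fo io); have := fb i (l i).-2; lia.
- apply/eqP; rewrite gtn_eqF // (bigD1 i0) //= [ltnRHS](bigD1 i0) //= -addSn.
  by rewrite leq_add // leq_sum.
Qed.

Lemma short_weightable2 : (exists2 i, i != o & l i %% 4 != 1) ->
  edge_weightable (theta r t l) 2.
Proof.
case=> i0 i0o li0; pose B i := if l i %% 4 == 0 then 2 else 1.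
have hB i : 1 <= B i <= 2 by rewrite /B; case: ifP.
pose f i := period4 2 (B i).
(* All first weights are 2, and the last weight is 1 unless the length is 1 mod 4. *)
have last i : i != o -> f i (l i).-1 <= f i 0 ?= iff (l i %% 4 == 1).
  move=> io; rewrite /f; have [-> _] := period4_last 2 (B i) (l_other io).
  rewrite /B /leqif; have := @ltn_pmod (l i) 4 isT.
  by case: (l i %% 4) => [|[|[|[|//]]]].
apply: (@short_weightable 2 f) => // [i j|i j _ _|i|].
- exact: period4_bound.
- exact: period4_SS.
- by case: (eqVneq i o) => [->|/last[]//]; rewrite l_o.
- by exists i0; rewrite (ltn_leqif (last _ i0o)).
Qed.

Lemma short_weightable3 : (forall i, i != o -> l i %% 4 = 1) ->
  edge_weightable (theta r t l) 3.
Proof.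
move=> l1; pose f (i : 'I_s) j := if j is 0 then 3 else period4 2 1 j.
have last i : i != o -> f i (l i).-1 = 2.
  move=> io; have [] := period4_last 2 1 (l_other io).
  by rewrite (l1 _ io) /f; have := l_other io; case: (l i) => [|[|n]].
have p12 j : 1 <= period4 2 1 j <= 2 by apply: period4_bound.
apply: (@short_weightable 3 f) => // [i [|j]|i [|j] _ _|i|] //=.
- by have := p12 j.+1; lia.
- exact: period4_SS.
- by case: (eqVneq i o) => [->|/last ->//]; rewrite l_o.
- by have [a ao _] := exists_third o o s_ge3; exists a; rewrite last.
Qed.

End ShortFirst.
End Half.

End Reduction.

(** * Assembly of the three cases *)

Theorem theorem3p6 (r s t : nat) (l : 'I_s -> nat)
    (hr : 3 <= r) (hs : 3 <= s) (ht : 1 <= t < r)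
    (* the vertices x_1, ..., x_t, y_1, ..., y_t are pairwise distinct *)
    (hl : forall i : 'I_s, 1 <= l i /\ 2 * t <= t + l i * (r - t)) :
  [/\ (2 * t < r -> chi_e_is (theta r t l) 1),
      (r < 2 * t ->
        let k := r %/ (r - t) in
        let cond := (r - t %| r) /\ (exists i : 'I_s, 2 * (k - 1) < l i) in
        (cond -> chi_e_is (theta r t l) 2) /\
        (~ cond -> chi_e_is (theta r t l) 1))
    & (2 * t = r ->
        (* only the first path may have length 1 *)
        (forall i : 'I_s, 0 < i -> 2 <= l i) ->
        let cond3 :=
          (forall i : 'I_s, i = 0 :> nat -> l i = 1) /\
          (forall i : 'I_s, 0 < i -> l i = 1 %[mod 4]) in
        let cond1 := forall i : 'I_s, l i = 2 in
        [/\ (cond3 -> chi_e_is (theta r t l) 3),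
            (cond1 -> chi_e_is (theta r t l) 1)
          & (~ cond3 -> ~ cond1 -> chi_e_is (theta r t l) 2)])].
Proof.
have [t0 tr] := andP ht.
have tl i : t <= l i * (r - t) by have [_] := hl i; lia.
have d0 : 0 < r - t by lia.
pose i0 : 'I_s := Ordinal hs.
split.
- exact: chi_theta_lt_half.
- move=> rt k cond.
  have kE : r - t %| r -> r = k * (r - t) by rewrite /k => /divnK ->.
  have k3 : r - t %| r -> 3 <= k.
    by move=> /kE rE; rewrite -(ltn_pmul2r d0) -rE; lia.
  split=> [[dv long]|nc].
    by apply: (chi_theta_long t0 tr tl (k3 dv) (kE dv)).
  case: (boolP (r - t %| r)) => dv; last exact: chi_theta_ndvd.
  apply: (chi_theta_short t0 tr tl (k3 dv) (kE dv) i0) => i.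
  by rewrite leqNgt; apply/negP => h; apply: nc; split=> //; exists i.
move=> rt l2 cond3 cond1.
have rt' : r = 2 * t by [].
pose o : 'I_s := Ordinal (leq_trans (isT : 0 < 3) hs).
have lo i : i != o -> 2 <= l i by rewrite -val_eqE /= -lt0n; apply: l2.
(* Here [r - t = t], so only a path of length 1 lacks inner vertices, and that can only be the first
   one. *)
have rep i : representative r t l i.
  apply/forallP => a; apply/implyP => /andP[/eqP e _].
  case: (posnP i) => [-> //|/l2 li].
  have : 2 * (r - t) <= l i * (r - t) by rewrite leq_pmul2r.
  lia.
have l1P : l o = 1 -> cond3 <-> (forall i, i != o -> l i %% 4 = 1).
  move=> l1; split=> [[_ h] i|h].
    by rewrite -val_eqE /= -lt0n; apply: h.
  split=> [i i0'|i ip]; first by rewrite (_ : i = o) //; apply: val_inj.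
  by apply: h; rewrite -val_eqE /= -lt0n.
have lo0 : 0 < l o by have [] := hl o.
split=> [c3|c1|n3 n1].
- have l1 : l o = 1 by case: c3 => + _; apply.
  have h := (l1P l1).1 c3.
  split; first exact: (short_weightable3 t0 tr tl rt' rep hs l1 lo h).
  move=> m wm; rewrite leqNgt; apply/negP => m3.
  apply: (not_weightable2 t0 tr tl rt' rep l1 h).
  case: wm => w [wb wp]; exists w; split=> // e /wb; lia.
- exact: (chi_half_two t0 tr tl rt' rep hs c1).
split; last first.
  move=> m wm; have m0 := weightable_gt0 t0 tr tl i0 wm.
  rewrite ltn_neqAle m0 andbT; apply/eqP => m1; rewrite -m1 in wm.
  apply: (not_weightable1 t0 tr tl rt' rep _ wm).
  (* Without a path of length 1 or of length at least 3, all lengths would be 2, contrary to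
     [n1]. *)
  case: (eqVneq (l o) 1) => l1; first by left; exists o.
  right; case: (pickP (fun i => 3 <= l i)) => [i li|h]; first by exists i.
  case: n1 => i; have := h i; case: (eqVneq i o) => [->|/lo]; lia.
case: (eqVneq (l o) 1) => l1.
  apply: (short_weightable2 t0 tr tl rt' rep hs l1 lo).
  case: (pickP (fun i => (i != o) && (l i %% 4 != 1))) => [i /andP[]|h].
    by exists i.
  case: n3; apply/(l1P l1) => i io; have := h i.
  by rewrite io => /negbFE/eqP.
apply: (half_weightable2_long t0 tr tl rt' rep hs) => i.
case: (eqVneq i o) => [->|/lo //]; lia.
Qed.
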